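(* Let $F$ be a field of characteristic not two and let $E$ be a finite-dimensional vector space over $F$ with an arbitrary symmetric bilinear form $(U,V)\mapsto U\cdot V$. Suppose an isosceles projective triangle $\overline{uvw}$ in $E$ has non-zero projective quadrances $q_u=q_v=q$ and $q_w$, and projective spreads $S_u=S_v=S$ and $S_w$, where $q_u=q(v,w)$, $q_v=q(u,w)$, $q_w=q(u,v)$, $S_u=S(uv,uw)$, $S_v=S(vw,vu)$ and $S_w=S(wu,wv)$. Then $$q_w=\frac{4q(1-S)(1-q)}{(1-Sq)^2},\qquad S_w=\frac{4S(1-S)(1-q)}{(1-Sq)^2}.$$
   Context: A projective point $u=[U]$ is a one-dimensional subspace of $E$, spanned by a non-zero vector $U$; it is null if $U\cdot U=0$, and non-null otherwise. For distinct projective points $u,v$, $uv$ denotes the projective line (two-dimensional subspace) they span. A projective triangle $\overline{uvw}$ is a set of three distinct projective points not contained in a common two-dimensional subspace; it is isosceles precisely when at least two of its projective quadrances are equal. The projective quadrance is defined between non-null projective points $u=[U]$, $v=[V]$ as $$q(u,v)=1-\frac{(U\cdot V)^2}{(U\cdot U)(V\cdot V)}.$$ The projective spread between the projective lines $wu$ and $wv$, where $u=[U]$, $v=[V]$, $w=[W]$ with $w$ non-null, is, putting $U'=U-\frac{U\cdot W}{W\cdot W}W$ and $V'=V-\frac{V\cdot W}{W\cdot W}W$, $$S(wu,wv)=1-\frac{(U'\cdot V')^2}{(U'\cdot U')(V'\cdot V')},$$ and it is undefined if one of the denominators is zero. The bilinear form is not assumed non-degenerate.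
   Formalization: The formal theorem additionally assumes 1 − Sq ≠ 0, so that the right-hand sides are defined; triangles with q = S = 1, such as the Euclidean [e1], [e1+e2], [e3], satisfy the stated hypotheses but give 0/0. *)

(* Defs.v *)
From HB Require Import structures.
From mathcomp Require Import all_boot all_order all_algebra.
From mathcomp Require Import ring.

Set Implicit Arguments.
Unset Strict Implicit.
Unset Printing Implicit Defensive.

Import GRing.Theory.
Local Open Scope ring_scope.

Section Projective.
Variables (F : fieldType) (E : vectType F) (B : {symmetric E}).
Implicit Types (u v w : {vspace E}) (U V W : E).

Definition proj_point u : Prop := \dim u = 1%N.

Definition proj_triangle u v w : Prop :=
  [/\ proj_point u, proj_point v & proj_point w] /\
  [/\ u <> v, u <> w & v <> w] /\
  ~ exists L : {vspace E}, \dim L = 2%N /\ [/\ (u <= L)%VS, (v <= L)%VS & (w <= L)%VS].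

(* The quantities below are computed on [vpick u], an arbitrary non-zero vector
   of the point u; [non_nullE], [quadranceE] and [spreadE] show that the choice
   of spanning vectors is irrelevant. *)
Definition non_null u : Prop := B (vpick u) (vpick u) != 0.

(* Meaningful only for non-null u and v. *)
Definition quadrance u v : F :=
  let U := vpick u in let V := vpick v in
  1 - B U V ^+ 2 / (B U U * B V V).

Definition reject W U : E := U - (B U W / B W W) *: W.

(* [spread w u v] is S(wu, wv): the first argument is the common point of the
   two lines. It depends only on w and the lines wu and wv, see
   [spread_lines] and [spreadC]. It is meaningful only when [spread_defined w u v]. *)
Definition spread w u v : F :=
  let W := vpick w in
  let U' := reject W (vpick u) in let V' := reject W (vpick v) in
  1 - B U' V' ^+ 2 / (B U' U' * B V' V').

Definition spread_defined w u v : Prop :=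
  let W := vpick w in
  let U' := reject W (vpick u) in let V' := reject W (vpick v) in
  [/\ B W W != 0, B U' U' != 0 & B V' V' != 0].

Definition isosceles_triangle u v w : Prop :=
  [/\ proj_triangle u v w,
      [/\ non_null u, non_null v & non_null w]
    & [\/ quadrance v w = quadrance u w,
          quadrance v w = quadrance u v
        | quadrance u w = quadrance u v]].

Lemma vpick_line U : U != 0 -> exists2 k, k != 0 & vpick <[U]>%VS = k *: U.
Proof.
move=> U0; have /vlineP[k kE] := memv_pick <[U]>%VS; exists k => //.
apply/eqP=> k0; have := vpick0 <[U]>%VS.
by rewrite kE k0 scale0r eqxx => /esym; rewrite -dimv_eq0 dim_vline U0.
Qed.

Lemma formZZ j k U V : B (j *: U) (k *: V) = j * k * B U V.
Proof. by rewrite linearZl_LR linearZr_LR /= mulrA. Qed.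

Lemma form_neq0 U : B U U != 0 -> U != 0.
Proof. by apply: contra_neq => ->; rewrite linear0r. Qed.

Lemma ratioZ j k U V : j != 0 -> k != 0 ->
  B (j *: U) (k *: V) ^+ 2 / (B (j *: U) (j *: U) * B (k *: V) (k *: V))
  = B U V ^+ 2 / (B U U * B V V).
Proof.
move=> j0 k0; have jk0 : (j * k) ^+ 2 != 0 by rewrite expf_neq0 ?mulf_neq0.
have -> : B (j *: U) (j *: U) * B (k *: V) (k *: V)
          = (j * k) ^+ 2 * (B U U * B V V) by rewrite !formZZ; ring.
by rewrite formZZ exprMn -mulf_div divff ?mul1r.
Qed.

Lemma rejectZ k j W U : k != 0 -> reject (k *: W) (j *: U) = j *: reject W U.
Proof.
move=> k0; rewrite /reject !formZZ scalerBr !scalerA; congr (_ - _ *: _).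
have [->|W0] := eqVneq (B W W) 0; first by rewrite mulr0 !invr0 !(mulr0, mul0r).
by field; rewrite k0 W0.
Qed.

Lemma reject_line W U a b : B W W != 0 ->
  reject W (a *: W + b *: U) = b *: reject W U.
Proof.
move=> W0; rewrite /reject linearDl !linearZl_LR /= scalerBr scalerA.
have -> : (a * B W W + b * B U W) / B W W = a + b * (B U W / B W W) by field.
by rewrite scalerDl opprD addrACA subrr add0r.
Qed.

Lemma non_nullE U : U != 0 -> non_null <[U]>%VS <-> B U U != 0.
Proof.
move=> /vpick_line[k k0 kE].
by rewrite /non_null kE formZZ !mulf_eq0 (negPf k0).
Qed.

Lemma quadranceE U V : B U U != 0 -> B V V != 0 ->
  quadrance <[U]>%VS <[V]>%VS = 1 - B U V ^+ 2 / (B U U * B V V).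
Proof.
move=> /form_neq0/vpick_line[j j0 jE] /form_neq0/vpick_line[k k0 kE].
by rewrite /quadrance jE kE ratioZ.
Qed.

Lemma spreadE W U V : B W W != 0 -> U != 0 -> V != 0 ->
  spread <[W]>%VS <[U]>%VS <[V]>%VS =
  1 - B (reject W U) (reject W V) ^+ 2
      / (B (reject W U) (reject W U) * B (reject W V) (reject W V)).
Proof.
move=> /form_neq0/vpick_line[i i0 iE] /vpick_line[j j0 jE] /vpick_line[k k0 kE].
by rewrite /spread iE jE kE !rejectZ // ratioZ.
Qed.

Lemma spread_definedE W U V : W != 0 -> U != 0 -> V != 0 ->
  spread_defined <[W]>%VS <[U]>%VS <[V]>%VS <->
  [/\ B W W != 0, B (reject W U) (reject W U) != 0
    & B (reject W V) (reject W V) != 0].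
Proof.
move=> /vpick_line[i i0 iE] /vpick_line[j j0 jE] /vpick_line[k k0 kE].
rewrite /spread_defined iE jE kE !rejectZ // !formZZ !mulf_eq0.
by rewrite (negPf i0) (negPf j0) (negPf k0).
Qed.

Lemma point_line u : proj_point u -> u = <[vpick u]>%VS.
Proof.
move=> u1; apply/esym/eqP; rewrite eqEdim -memvE memv_pick u1 dim_vline.
by rewrite vpick0 -dimv_eq0 u1.
Qed.

Lemma spreadC w u v : spread w u v = spread w v u.
Proof.
rewrite /spread /=; set X := reject _ _; set Y := reject _ (vpick v).
by rewrite (hermC B X Y) /= expr0 mul1r [B X X * _]mulrC.
Qed.

Lemma spread_lines w u u' v :
  proj_point w -> proj_point u -> proj_point u' -> non_null w -> u' <> w ->
  (w + u = w + u')%VS -> spread w u v = spread w u' v.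
Proof.
move=> pw pu pu' w0 uw' e.
have : vpick u' \in (w + u)%VS by rewrite e memvE (subv_trans _ (addvSr _ _)) // -memvE memv_pick.
rewrite {1}(point_line pw) {1}(point_line pu).
case/memv_addP=> _ /vlineP[a ->] [_ /vlineP[b ->] u'E].
have b0 : b != 0.
  apply/eqP=> b0; apply: uw'; apply/eqP; rewrite eqEdim pw pu' leqnn andbT.
  rewrite (point_line pu') -memvE u'E b0 scale0r addr0.
  by rewrite memvZ ?memv_pick.
rewrite /spread u'E reject_line // -[reject _ (vpick v)]scale1r.
by rewrite ratioZ ?oner_neq0 // scale1r.
Qed.

End Projective.

(* Main.v *)
Require Import Defs.
From mathcomp Require Import all_boot all_order all_algebra.
From mathcomp Require Import ring.
Import GRing.Theory.
Local Open Scope ring_scope.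

(** Everything about the triangle is encoded in the Gram matrix of
   spanning vectors U, V, W. Its determinant, divided by the product of the
   three diagonal entries, is
     [q_u + q_v + q_w - 2 + 2 p],
   where [p = (U.V)(V.W)(W.U) / ((U.U)(V.V)(W.W))] is the triple product of the
   three points. On the other hand [U'.U'], [V'.V'] and [U'.V'] are the entries
   of the Schur complement of [W.W], so the same number equals [S_w q_u q_v]
   ([cross_law]). As it does not depend on which vertex is singled out,
   [S_u q_v q_w = S_v q_u q_w = S_w q_u q_v] ([spread_law]).

   The triple product itself is known up to sign from the quadrances,
   [p^2 = (1 - q_u)(1 - q_v)(1 - q_w)] ([sqr_triple_product]). For
   [q_u = q_v = q] and [S_u = S], eliminating [p] gives
     [(S q q_w - 2 q - q_w + 2)^2 = 4 (1 - q)^2 (1 - q_w)],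
   and writing [t = 2 (1 - q)] the left side is [(t - q_w (1 - S q))^2]. The
   terms [t^2] cancel, a factor [q_w] divides out, and what is left is linear in
   [q_w]: this is the first formula. The second one follows from it because the
   spread law reads [S_w q = S q_w]. *)

Lemma symmetric_formC {F : fieldType} {E : vectType F} (B : {symmetric E})
  (U V : E) : B U V = B V U.
Proof. by rewrite (hermC B U V) /= expr0 mul1r. Qed.

Lemma form_reject {F : fieldType} {E : vectType F} (B : {symmetric E})
    (W U V : E) : B W W != 0 ->
  B (reject B W U) (reject B W V) = B U V - B U W * B V W / B W W.
Proof.
move=> W0; rewrite /reject linearBl !linearBr !linearZl_LR !linearZr_LR /=.
by rewrite (symmetric_formC B W V); field.
Qed.

(** Each vector occurs as often above as below, so this ratio depends only on
   the three points. The quadrances determine only its square. *)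
Definition triple_product {F : fieldType} {E : vectType F} (B : {symmetric E})
    (u v w : {vspace E}) : F :=
  let U := vpick u in let V := vpick v in let W := vpick w in
  B U V * B V W * B W U / (B U U * B V V * B W W).

Lemma triple_product_rot {F : fieldType} {E : vectType F} (B : {symmetric E})
    (u v w : {vspace E}) :
  triple_product B u v w = triple_product B v w u.
Proof. by rewrite /triple_product /=; congr (_ / _); ring. Qed.

Lemma quadranceC {F : fieldType} {E : vectType F} (B : {symmetric E})
    (u v : {vspace E}) : quadrance B u v = quadrance B v u.
Proof. by rewrite /quadrance /= symmetric_formC [B (vpick u) _ * _]mulrC. Qed.

Lemma sqr_triple_product {F : fieldType} {E : vectType F} (B : {symmetric E})
    (u v w : {vspace E}) : non_null B u -> non_null B v -> non_null B w ->
  triple_product B u v w ^+ 2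
  = (1 - quadrance B u v) * (1 - quadrance B v w) * (1 - quadrance B w u).
Proof.
rewrite /non_null /triple_product /quadrance /= => u0 v0 w0.
by field; rewrite u0 v0 w0.
Qed.

(** Both sides are the normalised Gram determinant of the three points: the
   right-hand side is its expansion, the left-hand side its computation by the
   Schur complement at [w]. The quadrances at [w] must be non-zero because they
   are the denominators of the spread, up to the non-zero factors [U.U] and
   [V.V]. *)
Lemma cross_law {F : fieldType} {E : vectType F} (B : {symmetric E})
    (u v w : {vspace E}) : non_null B u -> non_null B v -> non_null B w ->
    quadrance B u w != 0 -> quadrance B v w != 0 ->
  spread B w u v * (quadrance B u w * quadrance B v w)
  = quadrance B u v + quadrance B v w + quadrance B w u - 2%:R
    + 2%:R * triple_product B u v w.
Proof.
rewrite (quadranceC B w u) /non_null /triple_product /spread /quadrance /=.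
set U := vpick u; set V := vpick v; set W := vpick w => u0 v0 w0.
rewrite !form_reject // (symmetric_formC B W U).
set a := B U U in u0 *; set b := B V V in v0 *; set c := B W W in w0 *.
set x := B V W; set y := B U W; set z := B U V.
set qv := 1 - y ^+ 2 / (a * c); set qu := 1 - x ^+ 2 / (b * c) => qv0 qu0.
have -> : a - y * y / c = a * qv by rewrite /qv; field; rewrite u0 w0.
have -> : b - x * x / c = b * qu by rewrite /qu; field; rewrite v0 w0.
have -> : (1 - (z - y * x / c) ^+ 2 / (a * qv * (b * qu))) * (qv * qu)
          = qv * qu - (z - y * x / c) ^+ 2 / (a * b).
  by field; apply/and5P.
by rewrite /qv /qu; field; apply/and3P.
Qed.

(** The right-hand side of [cross_law] is invariant under cyclic permutation of
   the three points, and so is the left-hand side. *)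
Lemma spread_law {F : fieldType} {E : vectType F} (B : {symmetric E})
    (u v w : {vspace E}) : non_null B u -> non_null B v -> non_null B w ->
    quadrance B u v != 0 -> quadrance B v w != 0 -> quadrance B w u != 0 ->
  spread B w u v * (quadrance B w u * quadrance B v w)
  = spread B u v w * (quadrance B u v * quadrance B w u).
Proof.
move=> u0 v0 w0 uv0 vw0 wu0.
have := cross_law B u v w u0 v0 w0; have := cross_law B v w u v0 w0 u0.
rewrite (quadranceC B u w) (quadranceC B v u).
move=> /(_ uv0 wu0) -> /(_ wu0 vw0) ->.
by rewrite (triple_product_rot B u v w); ring.
Qed.

(** Here [r] is the quadrance of the base. Squaring the first equation solved
   for [2 p] leaves, once the terms free of [r] cancel, [r] times the
   conclusion; this is where [r != 0] is used. *)
Lemma isosceles_elimination {F : fieldType} (q r S p : F) : r != 0 ->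
    S * (q * r) = r + q + q - 2%:R + 2%:R * p ->
    p ^+ 2 = (1 - r) * (1 - q) * (1 - q) ->
  r * (1 - S * q) ^+ 2 = 4%:R * q * (1 - S) * (1 - q).
Proof.
move=> r0 cross p2; apply: (mulfI r0).
have tp : 2%:R * p = S * (q * r) - r - q - q + 2%:R by rewrite cross; ring.
have : (2%:R * p) ^+ 2 = 4%:R * ((1 - r) * (1 - q) * (1 - q)).
  by rewrite -p2; ring.
rewrite tp => sqr_cross; apply/eqP; rewrite -subr_eq0.
by move/eqP: sqr_cross; rewrite -subr_eq0 => /eqP <-; apply/eqP; ring.
Qed.

Theorem theorem17 (F : fieldType) (charF : 2%N \notin [pchar F])
    (E : vectType F) (B : {symmetric E})
    (u v w : {vspace E}) (q qw S Sw : F)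
    (isosc : isosceles_triangle B u v w)
    (qu_eq : quadrance B v w = q)
    (qv_eq : quadrance B u w = q)
    (qw_eq : quadrance B u v = qw)
    (q_neq0 : q != 0)
    (qw_neq0 : qw != 0)
    (Su_def : spread_defined B u v w)
    (Sv_def : spread_defined B v w u)
    (Sw_def : spread_defined B w u v)
    (Su_eq : spread B u v w = S)
    (Sv_eq : spread B v w u = S)
    (Sw_eq : spread B w u v = Sw)
    (den_neq0 : 1 - S * q != 0) :
  qw = 4%:R * q * (1 - S) * (1 - q) / (1 - S * q) ^+ 2 /\
  Sw = 4%:R * S * (1 - S) * (1 - q) / (1 - S * q) ^+ 2.
Proof.
case: isosc => _ [u0 v0 w0] _.
have wu_eq : quadrance B w u = q by rewrite quadranceC.
have nz : [/\ quadrance B u v != 0, quadrance B v w != 0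
            & quadrance B w u != 0] by rewrite qw_eq qu_eq wu_eq.
case: nz => uv0 vw0 wu0.
have qwE : qw = 4%:R * q * (1 - S) * (1 - q) / (1 - S * q) ^+ 2.
  apply: (canRL (mulfK (expf_neq0 2 den_neq0))).
  apply: (isosceles_elimination _ _ _ (triple_product B u v w)) => //.
    have := cross_law B v w u v0 w0 u0.
    rewrite (quadranceC B v u) Su_eq qw_eq wu_eq qu_eq.
    rewrite -(triple_product_rot B u v w).
    by move=> /(_ qw_neq0 q_neq0) H; rewrite [q * qw]mulrC H; ring.
  by rewrite sqr_triple_product // qw_eq qu_eq wu_eq.
split=> //.
have SwE : Sw * q = S * qw.
  have := spread_law B u v w u0 v0 w0 uv0 vw0 wu0.
  rewrite Sw_eq Su_eq qw_eq qu_eq wu_eq !mulrA; exact: mulIf.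
by apply: (mulIf q_neq0); rewrite SwE qwE; field.
Qed.
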